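(* Let $X$ be a zero-dimensional $T_1$-space, and let $\mathcal I$ be an ideal of compact subsets of $X$. Then the space $C_{\mathcal I}(X,\mathbf 2)$ is sequential if and only if for every clopen $\mathcal I$-cover $\gamma$ of $X$ either $X\in\gamma$ or there is a sequence $\{U_n\}_{n\in\omega}$ in $\gamma$ such that (i) the set $W_0:=\lim_n U_n$ is a clopen subset of $X$ and $W_0\notin\gamma$; (ii) the set $W_0$ is $\mathcal I$-covered by $\{U_n\}_{n\in\omega}$, i.e. for every $F\in\mathcal I$ with $F\subseteq W_0$ there is $m\in\omega$ such that $F\subseteq U_n$ for all $n\ge m$; (iii) the set $X\setminus W_0$ is $\mathcal I$-covered by $\{X\setminus U_n\}_{n\in\omega}$, i.e. for every $F\in\mathcal I$ with $F\subseteq X\setminus W_0$ there is $m\in\omega$ such that $F\subseteq X\setminus U_n$ for all $n\ge m$.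
   Context: An ideal of compact subsets of a topological space $X$ is a family $\mathcal I$ of compact subsets of $X$ with $\bigcup\mathcal I=X$ such that for all $A,B\in\mathcal I$ and every compact $K\subseteq X$ one has $A\cup B\in\mathcal I$ and $A\cap K\in\mathcal I$. $\mathbf 2$ is the discrete two-element space. $C_{\mathcal I}(X,\mathbf 2)$ is the set of all continuous functions $X\to\mathbf 2$ with the $\mathcal I$-open topology, whose subbase consists of the sets $\{f: f(K)\subseteq U\}$ with $K\in\mathcal I$ and $U\subseteq\mathbf 2$. Zero-dimensional means having a base of clopen sets. A family $\gamma$ of subsets of $X$ is an $\mathcal I$-cover if every $A\in\mathcal I$ is contained in some $U\in\gamma$; it is clopen if every member is closed and open in $X$. $\lim_n U_n$ denotes the set-theoretic limit: $W_0=\lim_n U_n$ means $W_0=\bigcup_{n}\bigcap_{i\ge n}U_i=\bigcap_n\bigcup_{i\ge n}U_i$. A topological space is sequential if for each non-closed subset $A$ there is a sequence in $A$ converging to some point of $\overline A\setminus A$. *)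

(* Defs.v *)
From HB Require Import structures.
From mathcomp Require Import all_boot all_order all_algebra.
From mathcomp Require Import all_classical all_reals topology.

Set Implicit Arguments.
Unset Strict Implicit.
Unset Printing Implicit Defensive.

Local Open Scope classical_set_scope.

(* Not MathComp-Analysis's [zero_dimensional], which only asks that clopen sets
   separate points. *)
Definition has_clopen_base (X : topologicalType) : Prop :=
  exists2 B : set (set X), basis B & B `<=` clopen.

(* Non-emptiness of the family follows from [\bigcup_(A in I) A = setT] as soon
   as X is inhabited; requiring it excludes only the empty family on the empty
   space. *)
Record compact_ideal (X : topologicalType) (I : set (set X)) : Prop := {
  compact_ideal_neq0 : I !=set0 ;
  compact_ideal_compact : forall A, I A -> compact A ;
  compact_ideal_cover : \bigcup_(A in I) A = [set: X] ;
  compact_idealU : forall A B, I A -> I B -> I (A `|` B) ;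
  compact_idealI : forall A K, I A -> compact K -> I (A `&` K)
}.

(* C_I(X, 2); [bool] carries the discrete topology. *)
Definition cfun2 (X : topologicalType) (I : set (set X)) : Type :=
  continuousType X bool.

Section ideal_open_topology.
Context (X : topologicalType) (I : set (set X)).

Definition ideal_open_subbase : set (set (cfun2 I)) :=
  [set V | exists K (U : set bool), I K /\
     V = [set f : continuousType X bool | f @` K `<=` U]].

HB.instance Definition _ := Choice.copy (cfun2 I) (continuousType X bool).
HB.instance Definition _ :=
  isSubBaseTopological.Build (cfun2 I) ideal_open_subbase id.

End ideal_open_topology.

Definition sequential_space (T : topologicalType) : Prop :=
  forall A : set T, ~ closed A ->
    exists (u : nat -> T) (x : T),
      [/\ forall n, A (u n), u @ \oo --> x & (closure A `\` A) x].

Definition ideal_cover (X : Type) (I gamma : set (set X)) : Prop :=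
  forall A, I A -> exists2 U, gamma U & A `<=` U.

Definition clopen_ideal_cover (X : topologicalType) (I gamma : set (set X)) :=
  gamma `<=` clopen /\ ideal_cover I gamma.

Definition is_set_lim (X : Type) (U : nat -> set X) (W : set X) : Prop :=
  W = \bigcup_n \bigcap_(i >= n) U i /\ W = \bigcap_n \bigcup_(i >= n) U i.

Definition ideal_covered_by (X : Type) (I : set (set X)) (W : set X)
    (U : nat -> set X) : Prop :=
  forall F, I F -> F `<=` W ->
    exists m : nat, forall n : nat, (m <= n)%N -> F `<=` U n.

(* Main.v *)
Require Import Defs.
From mathcomp Require Import all_boot all_order all_algebra.
From mathcomp Require Import finmap.
From mathcomp Require Import all_classical all_reals topology.

(** Fix a continuous function [f] into the two-point space. The map
    [g |-> {x | g x = f x}] is a bijection between continuous functions and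
    clopen sets ([coincidence_inj], [coincidence_cfun2_onto]). This is the
    translation carrying [f] to the constant function true, so it places any
    chosen [f] at the clopen set [X]; working with coincidence sets relative to
    [f] avoids proving that translations are homeomorphisms.

    Through this bijection the topology becomes a statement about covers. Since
    members of the ideal may be united and cut by clopen sets, the functions
    that agree with [f] on one member of the ideal form a base of neighbourhoods
    at [f] ([nbhs_cfun2P]). Hence [f] is adherent to [A] exactly when the
    coincidence sets of the members of [A] with [f] form an ideal cover
    ([closure_cfun2P]), and [u n] tends to [h] exactly when the coincidence sets
    of [u n] satisfy the two covering conditions relative to that of [h]
    ([cvg_cfun2P]). Points belong to the ideal, so those conditions already
    force the set-theoretic limit ([set_lim_ideal_covered]).

    The theorem is then a translation. A clopen ideal cover without [X] is a set
    of functions whose closure contains the constant true but which does not,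
    and a sequence leaving that set is the required sequence of clopen sets.
    Conversely, if [f] is adherent to [A] but not in [A], the coincidence sets
    of [A] with [f] are a clopen ideal cover without [X], and the sequence that
    the covering property provides is a sequence of [A] converging outside
    [A]. *)

Local Open Scope classical_set_scope.

Definition coincidence {X : Type} (f g : X -> bool) : set X :=
  [set x | f x = g x].

(** Two values suffice: each of [g x] and [h x] is equal to [f x] or is the
    other boolean, so knowing which determines it. *)
Lemma coincidence_inj {X : Type} (f g h : X -> bool) :
  coincidence g f = coincidence h f -> g =1 h.
Proof.
move=> gh x; have /propeqP[gh1 gh2] : coincidence g f x = coincidence h f x.
  by rewrite gh.
have : (g x == f x) = (h x == f x) by apply/eqP/eqP; [exact: gh1|exact: gh2].
by case: (g x); case: (h x); case: (f x).
Qed.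

Lemma clopen_coincidence {X : topologicalType} {f g : X -> bool} :
  continuous f -> continuous g -> clopen (coincidence f g).
Proof.
move=> cf cg.
have clb (h : X -> bool) b : continuous h -> clopen (h @^-1` [set b]).
  move=> ch; apply: preimage_clopen => //.
  by split; [exact: discrete_open|exact: discrete_closed].
have -> : coincidence f g =
    (f @^-1` [set true] `&` g @^-1` [set true]) `|`
    (f @^-1` [set false] `&` g @^-1` [set false]).
  apply/seteqP; split=> x; rewrite /coincidence /=.
    by move=> ->; case: (g x); [left|right].
  by move=> [] [-> ->].
by apply: clopenU; apply: clopenI; exact: clb.
Qed.

Lemma continuous_indicator {X : topologicalType} {U : set X} :
  clopen U -> continuous (fun x => x \in U).
Proof.
move=> [oU cU]; apply/continuousP => B _.
have -> : (fun x => x \in U) @^-1` B =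
    (U `&` [set _ | B true]) `|` (~` U `&` [set _ | B false]).
  apply/seteqP; split=> x /=.
    have [/set_mem|/negP nUx] := boolP (x \in U); first by left.
    by right; split=> // Ux; apply: nUx; exact: mem_set.
  by move=> [] [] => [/(@mem_set _ U)|/(@memNset _ U)] ->.
have oc (P : Prop) : open [set _ : X | P].
  have [p|np] := pselect P.
    suff -> : [set _ : X | P] = setT by exact: openT.
    by apply/seteqP; split.
  suff -> : [set _ : X | P] = set0 by exact: open0.
  by apply/seteqP; split.
by apply: openU; apply: openI => //; exact: closed_openC.
Qed.

Lemma compact_ideal_closedI {X : topologicalType} {I : set (set X)} {F C : set X} :
  compact_ideal I -> I F -> closed C -> I (F `&` C).
Proof.
move=> idI IF cC; rewrite -[F]setIid -setIA.
by apply: (compact_idealI idI) => //; apply: compact_closedI => //;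
  exact: (compact_ideal_compact idI).
Qed.

Lemma compact_ideal1 {X : topologicalType} {I : set (set X)} (x : X) :
  compact_ideal I -> I [set x].
Proof.
move=> idI; have : [set: X] x by [].
rewrite -(compact_ideal_cover idI) => -[A IA Ax].
have -> : [set x] = A `&` [set x].
  by apply/seteqP; split=> [y ->|y []].
exact: (compact_idealI idI) (@compact_set1 _ x).
Qed.

Section coincidence_in_cfun2.
Context {X : topologicalType} {I : set (set X)} (idI : compact_ideal I).
Implicit Types (f g h : cfun2 I) (A V : set (cfun2 I)) (u : nat -> cfun2 I).

Lemma clopen_coincidence_cfun2 f g : clopen (coincidence f g).
Proof. by apply: clopen_coincidence; exact: cts_fun. Qed.

(** The witness compares the indicator of [W] with [f]: it equals [f] where the
    indicator is true, and differs from [f] where it is false. *)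
Lemma coincidence_cfun2_onto f {W : set X} :
  clopen W -> exists h, coincidence h f = W.
Proof.
move=> cloW.
have cWf := clopen_coincidence (continuous_indicator cloW) (@cts_fun _ _ f).
pose h : cfun2 I := mkcts (continuous_indicator cWf).
have hE x : h x = ((x \in W) == f x).
  rewrite /h /= /mkcts; apply/idP/eqP => [/set_mem //|E].
  exact: mem_set.
exists h; apply/seteqP; split=> x; rewrite /coincidence /= hE.
  by case: (boolP (x \in W)) => [/set_mem //|_]; case: (f x).
by move=> /mem_set ->; case: (f x).
Qed.

Lemma open_subbasic {K : set X} {U : set bool} : I K ->
  open [set f : cfun2 I | [set f x | x in K] `<=` U].
Proof.
move=> IK; set S := [set f | _].
exists [set S]; last by rewrite bigcup_set1.
move=> _ ->; apply: (finI_from1 id).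
by exists K, U.
Qed.

(** The finite intersection of subbasic sets that a neighbourhood contains is
    listed in a sequence, so that it can be treated by induction. *)
Lemma nbhs_subbase f V : nbhs f V ->
  exists2 s : seq (set (cfun2 I)),
    forall B, B \in s -> ideal_open_subbase B /\ B f &
    [set g | forall B, B \in s -> B g] `<=` V.
Proof.
rewrite nbhsE => -[O [[D DI <-] [S DS Sf]] DV].
have [E EI ES] := DI _ DS; exists (enum_fset E) => [B BE|g gE].
  split; first exact/set_mem/EI.
  by have : S f := Sf; rewrite -ES; apply.
have Sg : S g by rewrite -ES => B BE; exact: gE.
by apply: DV; exists S.
Qed.

(** The union of the members of the ideal that define the given subbasic sets
    works, because a function that agrees with [f] on [K] has the same image of
    [K] as [f]; the empty list requires the ideal to have a member at all. *)
Lemma agree_subbasics (f : cfun2 I) (s : seq (set (cfun2 I))) :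
  (forall B, B \in s -> ideal_open_subbase B /\ B f) ->
  exists2 F, I F &
    forall g : cfun2 I, F `<=` coincidence g f -> forall B, B \in s -> B g.
Proof.
elim: s => [_|B s IHs sf].
  by have [F IF] := compact_ideal_neq0 idI; exists F.
have [|F IF Fs] := IHs; first by move=> C Cs; apply: sf; rewrite inE Cs orbT.
have [|[K [U [IK BKU]]] Bf] := sf B; first by rewrite inE eqxx.
exists (K `|` F); first exact: (compact_idealU idI).
move=> g KFg C; rewrite inE => /orP[/eqP ->|]; last first.
  by apply: Fs => x Fx; apply: KFg; right.
move: Bf; rewrite BKU /= => fKU _ [x Kx <-].
rewrite (KFg x) //; last by left.
by apply: fKU; exists x.
Qed.

(** Agreement with [f] on [F] is a neighbourhood of [f] because it is the
    conjunction of two subbasic conditions, one on each of the pieces of [F]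
    where [f] is constant; being cut out of [F] by a closed set, these pieces
    are in the ideal. *)
Lemma nbhs_cfun2P f V : nbhs f V <->
  exists2 F, I F & [set g : cfun2 I | F `<=` coincidence g f] `<=` V.
Proof.
split=> [/nbhs_subbase[s sf sV]|[F IF FV]].
  have [F IF Fs] := agree_subbasics _ _ sf; exists F => // g Fg.
  by apply: sV; exact: Fs.
have cK b : I (F `&` f @^-1` [set b]).
  apply: (compact_ideal_closedI idI IF); apply: preimage_closed.
    by move=> x _; exact: cts_fun.
  exact: discrete_closed.
pose O b := [set g : cfun2 I | [set g x | x in F `&` f @^-1` [set b]] `<=` [set b]].
have nO b : nbhs f (O b).
  apply: open_nbhs_nbhs; split; first exact: open_subbasic.
  by move=> _ [x [_ /= ->] <-].
apply: filterS (filterI (nO true) (nO false)) => g [gT gF]; apply: FV => x Fx.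
rewrite /coincidence /=; case fx: (f x).
  by apply: gT; exists x.
by apply: gF; exists x.
Qed.

Lemma closure_cfun2P A f : closure A f <->
  ideal_cover I [set coincidence (g : cfun2 I) f | g in A].
Proof.
split=> [Af F IF|Acov V /nbhs_cfun2P[F IF FV]].
  have [|g [Ag Fg]] := Af [set g : cfun2 I | F `<=` coincidence g f].
    by apply/nbhs_cfun2P; exists F.
  by exists (coincidence g f) => //; exists g.
have [_ [g Ag <-] Fg] := Acov _ IF.
by exists g; split=> //; exact: FV.
Qed.

(** The limit [h] and the base point [f] need not be related: the functions
    [u n] and [h] agree at a point exactly when both or neither of them agree
    with [f] there. A member of the ideal is therefore split along the clopen
    set where [h] agrees with [f], and each covering condition handles one
    piece. *)
Lemma cvg_cfun2P u h f : u @ \oo --> h <->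
  ideal_covered_by I (coincidence h f) (fun n => coincidence (u n) f) /\
  ideal_covered_by I (~` coincidence h f) (fun n => ~` coincidence (u n) f).
Proof.
split=> [uh|[uW uCW] V /nbhs_cfun2P[F IF FV]].
  have ev F : I F -> exists m, forall n, (m <= n)%N -> F `<=` coincidence (u n) h.
    move=> IF; have : nbhs h [set g : cfun2 I | F `<=` coincidence g h].
      by apply/nbhs_cfun2P; exists F.
    by move=> /uh [m _ mF]; exists m => n; exact: mF.
  split=> F /ev[m mF] FW; exists m => n /mF Fu x Fx.
    by rewrite /coincidence /= (Fu x Fx); exact: FW.
  by rewrite /coincidence /= (Fu x Fx); exact: FW.
have [clo1 clo2] := clopen_coincidence_cfun2 h f.
have [|m1 m1F] := uW _ (compact_ideal_closedI idI IF clo2); first by move=> x [].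
have [|m2 m2F] := uCW _ (compact_ideal_closedI idI IF (open_closedC clo1)).
  by move=> x [].
exists (maxn m1 m2) => // n /=; rewrite geq_max => /andP[m1n m2n].
apply: FV => x Fx; have [hf|nhf] := pselect (h x = f x).
  have ux : u n x = f x := m1F _ m1n x (conj Fx hf).
  by rewrite /coincidence /= ux.
have := m2F _ m2n x (conj Fx nhf); move: nhf; rewrite /coincidence /=.
by case: (u n x); case: (h x); case: (f x).
Qed.

End coincidence_in_cfun2.

(** Singletons are in the ideal, so every point is eventually in, or eventually
    out of, the sets [U n], according to its position with respect to [W]. *)
Lemma set_lim_ideal_covered {X : topologicalType} {I : set (set X)}
    {W : set X} {U : nat -> set X} :
  compact_ideal I -> ideal_covered_by I W U ->
  ideal_covered_by I (~` W) (fun n => ~` U n) -> is_set_lim U W.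
Proof.
move=> idI WU CWU.
have inW x : W x -> exists m, forall n, (m <= n)%N -> U n x.
  move=> Wx; have [|m mU] := WU _ (compact_ideal1 x idI); first by move=> _ ->.
  by exists m => n /mU; apply.
have outW x : ~ W x -> exists m, forall n, (m <= n)%N -> ~ U n x.
  move=> Wx; have [|m mU] := CWU _ (compact_ideal1 x idI); first by move=> _ ->.
  by exists m => n /mU; apply.
split; apply/seteqP; split=> x.
- by move=> /inW[m mU]; exists m.
- move=> [m _ mU]; apply: contrapT => /outW[k kU].
  by apply: (kU (maxn m k)); [exact: leq_maxr|apply: mU; exact: leq_maxl].
- move=> /inW[m mU] k _; exists (maxn m k); first exact: leq_maxr.
  by apply: mU; exact: leq_maxl.
- move=> xU; apply: contrapT => /outW[m mU].
  by have [k mk] := xU m Logic.I; exact: mU.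
Qed.

Theorem theorem3p8 (X : topologicalType) (I : set (set X))
    (zX : has_clopen_base X) (t1X : accessible_space X)
    (idI : compact_ideal I) :
  sequential_space (cfun2 I) <->
  (forall gamma : set (set X), clopen_ideal_cover I gamma ->
     gamma [set: X] \/
     exists (U : nat -> set X) (W0 : set X),
       [/\ forall n, gamma (U n),
           [/\ is_set_lim U W0, clopen W0 & ~ gamma W0],
           ideal_covered_by I W0 U &
           ideal_covered_by I (~` W0) (fun n => ~` U n)]).
Proof.
split=> [seqI gamma [gclo gcov]|H A nclA].
  have [gT|ngT] := pselect (gamma [set: X]); [by left|right].
  (* Relative to the constant true, a clopen set is its own coincidence set. *)
  pose one : cfun2 I := mkcts (@cst_continuous X bool true).
  pose A : set (cfun2 I) := [set g | gamma (coincidence g one)].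
  have A1 : closure A one.
    apply/(closure_cfun2P idI) => F /gcov[U gU FU].
    have [g gE] := coincidence_cfun2_onto one (gclo _ gU).
    by exists U => //; exists g => //; rewrite /A /= gE.
  have nclA : ~ closed A.
    move=> /closure_id AE; apply: ngT; move: A1; rewrite -AE /A /=.
    by congr gamma; apply/seteqP; split.
  have [u [h [Au uh [_ nAh]]]] := seqI A nclA.
  have [cW cCW] := (cvg_cfun2P idI u h one).1 uh.
  exists (fun n => coincidence (u n) one), (coincidence h one).
  split=> //; split=> //; first exact: (set_lim_ideal_covered idI).
  exact: clopen_coincidence_cfun2.
have [f Af nAf] : exists2 f, closure A f & ~ A f.
  apply: contrapT => nex; apply: nclA => f Af; apply: contrapT => nAf.
  by apply: nex; exists f.
pose gamma := [set coincidence g f | g in A].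
have inA (g h : cfun2 I) : A g -> coincidence g f = coincidence h f -> A h.
  by move=> Ag /coincidence_inj /continuousEP <-.
(* A full coincidence set would come from [f] itself, which is not in [A]. *)
have [|[g Ag gT]|[U [W0 [gU [_ cloW0 nW0] cW cCW]]]] := H gamma.
- split; first by move=> _ [g _ <-]; exact: clopen_coincidence_cfun2.
  exact/(closure_cfun2P idI).
- exfalso; apply: nAf; apply: (inA g) => //.
  by rewrite gT; apply/seteqP; split.
have /choice [u uP] : forall n, exists g, A g /\ coincidence g f = U n.
  by move=> n; have [g Ag gE] := gU n; exists g.
have [h hW] := coincidence_cfun2_onto f cloW0.
have UE : U = fun n => coincidence (u n) f.
  by apply/funext => n; have [] := uP n.
have uh : u @ \oo --> h by rewrite (cvg_cfun2P idI u h f) hW; subst U.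
exists u, h; split=> [n||] //; first by have [] := uP n.
split; last by move=> Ah; apply: nW0; exists h.
move=> V /uh[m _ mV]; exists (u m); split; last exact: (mV m (leqnn m)).
by have [] := uP m.
Qed.
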